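(* Let $\varphi$ and $\psi$ be modal CNF formulas, let $\sigma$ be a consistent permutation that is a symmetry of $\varphi$, and let $\mathcal{C}$ be a class of models that is closed under accessibility relations and closed under $\sigma$. Then $\varphi \models_{\mathcal{C}} \psi$ if and only if $\varphi \models_{\mathcal{C}} \sigma(\psi)$.
   Context: Fix a modal signature $\langle \mathsf{Atom}, \mathsf{Mod}\rangle$ of two countable disjoint sets. A literal is $a$ or $\neg a$ with $a \in \mathsf{Atom}$; $\mathsf{ALit}$ is the set of literals, and for a literal $l$, $\neg l$ is its complement ($\neg\neg a = a$). A modal CNF formula is a finite set of modal CNF clauses (read conjunctively); a modal CNF clause is a finite set (read disjunctively) of literals and modal literals; a modal literal is $[m]C$ or $\neg[m]C$ with $m\in\mathsf{Mod}$ and $C$ a modal CNF clause. Some modalities may be indexed by an atom $a$ (written $m(a)$, e.g. hybrid $@_i$). Models (coinductive): for a nonempty set $W$, $\mathbf{Mods}_W$ is the (coinductively defined) class of tuples $\langle w,W,V,R\rangle$ with $w\in W$, $V(v)\subseteq \mathsf{Atom}$ for $v\in W$, and $R(m,v)\subseteq \mathbf{Mods}_W$ for $m\in\mathsf{Mod}$, $v\in W$; $\mathbf{Mods}=\bigcup_W \mathbf{Mods}_W$. For $\mathcal{M}\in\mathbf{Mods}_W$, $\mathrm{Ext}(\mathcal{M})$ is the smallest subset of $\mathbf{Mods}_W$ containing $\mathcal{M}$ such that $\mathcal{N}\in\mathrm{Ext}(\mathcal{M})$ implies $R^{\mathcal{N}}(m,v)\subseteq \mathrm{Ext}(\mathcal{M})$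 for all $m,v$. A class $\mathcal{C}$ is closed under accessibility relations if $\mathcal{M}\in\mathcal{C}$ implies $\mathrm{Ext}(\mathcal{M})\subseteq\mathcal{C}$. Satisfaction for $\mathcal{M}=\langle w,W,V,R\rangle$: $\mathcal{M}\models\varphi$ iff $\mathcal{M}\models C$ for all $C\in\varphi$; $\mathcal{M}\models C$ iff $\mathcal{M}\models \lambda$ for some $\lambda\in C$; $\mathcal{M}\models a$ iff $a\in V(w)$; $\mathcal{M}\models\neg a$ iff $a\notin V(w)$; $\mathcal{M}\models[m]C$ iff $\mathcal{N}\models C$ for all $\mathcal{N}\in R(m,w)$; $\mathcal{M}\models\neg[m]C$ iff $\mathcal{M}\not\models[m]C$. For a class $\mathcal{C}$, $\mathrm{Mod}_{\mathcal{C}}(\varphi)=\{\mathcal{M}\in\mathcal{C}:\mathcal{M}\models\varphi\}$, and $\varphi\models_{\mathcal{C}}\psi$ iff $\mathrm{Mod}_{\mathcal{C}}(\varphi)\subseteq\mathrm{Mod}_{\mathcal{C}}(\psi)$. Permutations: a permutation is a bijection $\sigma:\mathsf{ALit}\to\mathsf{ALit}$; throughout, permutations move only finitely many literals. $\sigma$ is consistent if $\sigma(\neg l)=\neg\sigma(l)$ for all literals $l$. For a modality, $\sigma(m(a))=m(\sigma(a))$ if $m$ is indexed by atom $a$, and $\sigma(m)=m$ otherwise. On formulas: $\sigma(\varphi)=\{\sigma(C):C\in\varphi\}$, $\sigma(C)=\{\sigma(\lambda):\lambda\in C\}$, $\sigma([m]C)=[\sigma(m)]\sigma(C)$, $\sigma(\neg[m]C)=\neg[\sigma(m)]\sigma(C)$.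 $\sigma$ is a symmetry of $\varphi$ if $\sigma(\varphi)=\varphi$ (as sets of sets). Permuted models: for $S\subseteq\mathsf{Atom}$, $L_S=S\cup\{\neg a: a\in\mathsf{Atom}\setminus S\}$. For $\mathcal{M}=\langle w,W,V,R\rangle$, $\sigma(\mathcal{M})=\langle w,W,V',R'\rangle$ with $V'(v)=\sigma(L_{V(v)})\cap\mathsf{Atom}$ and $R'(m,v)=\{\sigma(\mathcal{N}):\mathcal{N}\in R(\sigma(m),v)\}$ (defined coinductively). A class $\mathcal{C}$ is closed under $\sigma$ if $\sigma(\mathcal{M})\in\mathcal{C}$ for every $\mathcal{M}\in\mathcal{C}$.
   Formalization: Permuted models use R'(m,v) = {σ(N) : N ∈ R(σ⁻¹(m),v)} instead of R(σ(m),v), since with the latter the claim fails for a 3-cycle acting on indexed modalities; m(σ(a)) with σ(a) = ¬b is read as m(b). *)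

(* Defs.v *)
From HB Require Import structures.
From mathcomp Require Import all_boot.
From mathcomp Require Import boolp classical_sets.

Set Implicit Arguments.
Unset Strict Implicit.
Unset Printing Implicit Defensive.

Local Open Scope classical_set_scope.

(** The modalities of a signature are the unindexed ones, [plain], together
    with one modality [k(a)] for each family [k : family] and each atom [a]
    (as for the hybrid operators [@_i]). *)
Record signature := Signature {
  atom : countType;
  plain : countType;
  family : countType
}.

Inductive modality (S : signature) :=
| Plain of plain S
| Indexed of family S & atom S.

Inductive literal (S : signature) :=
| Pos of atom S
| Neg of atom S.

Arguments Plain {S}.
Arguments Indexed {S}.
Arguments Pos {S}.
Arguments Neg {S}.

Section Countability.
Variable S : signature.

Definition modality_code (m : modality S) : plain S + family S * atom S :=
  match m with Plain p => inl p | Indexed k a => inr (k, a) end.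
Definition modality_decode (c : plain S + family S * atom S) : modality S :=
  match c with inl p => Plain p | inr (k, a) => Indexed k a end.
Lemma modality_codeK : cancel modality_code modality_decode.
Proof. by case. Qed.

Definition literal_code (l : literal S) : atom S + atom S :=
  match l with Pos a => inl a | Neg a => inr a end.
Definition literal_decode (c : atom S + atom S) : literal S :=
  match c with inl a => Pos a | inr a => Neg a end.
Lemma literal_codeK : cancel literal_code literal_decode.
Proof. by case. Qed.

End Countability.

HB.instance Definition _ (S : signature) :=
  Countable.copy (modality S) (can_type (@modality_codeK S)).
HB.instance Definition _ (S : signature) :=
  Countable.copy (literal S) (can_type (@literal_codeK S)).

Section Syntax.
Variable S : signature.

Definition compl (l : literal S) : literal S :=
  match l with Pos a => Neg a | Neg a => Pos a end.

Definition atom_of (l : literal S) : atom S :=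
  match l with Pos a => a | Neg a => a end.

(** Finite sets are represented by sequences; equality of the sets they
    denote is [clause_eq] and [formula_eq] below, which ignore order and
    repetition at every nesting level. *)
Inductive clit :=
| Lit of literal S
| Box of modality S & seq clit
| NBox of modality S & seq clit.

Definition clause := seq clit.
Definition formula := seq clause.

Definition seteq_by (T : Type) (e : T -> T -> bool) (s t : seq T) : bool :=
  all (fun x => has (fun y => e x y) t) s &&
  all (fun y => has (fun x => e x y) s) t.

Fixpoint clit_eq (x y : clit) {struct x} : bool :=
  match x, y with
  | Lit l, Lit l' => l == l'
  | Box m C, Box m' C' => (m == m') && seteq_by clit_eq C C'
  | NBox m C, NBox m' C' => (m == m') && seteq_by clit_eq C C'
  | _, _ => false
  end.

Definition clause_eq : clause -> clause -> bool := seteq_by clit_eq.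
Definition formula_eq : formula -> formula -> bool := seteq_by clause_eq.

End Syntax.

Section Models.
Variable S : signature.

Local Set Primitive Projections.

(** A subset [R(m, v)] of the class of models over [W] is given as the range
    of a family [succ m v] indexed by a type [idx m v]. *)
CoInductive model (W : Type) : Type := Model {
  actual : W;
  valuation : W -> set (atom S);
  idx : modality S -> W -> Type;
  succ : forall (m : modality S) (v : W), idx m v -> model W
}.

End Models.

Arguments actual {S W}.
Arguments valuation {S W}.
Arguments idx {S W}.
Arguments succ {S W} _ {m v} _.

Section Classes.
Variable S : signature.

Definition bisimulation (W : Type) (B : model S W -> model S W -> Prop) : Prop :=
  forall M N, B M N ->
  [/\ actual M = actual N,
      forall v, valuation M v = valuation N v,
      forall m v (i : idx M m v), exists j : idx N m v, B (succ M i) (succ N j)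
    & forall m v (j : idx N m v), exists i : idx M m v, B (succ M i) (succ N j)].

(** Equality of coinductively defined (non-well-founded) models. *)
Definition model_eq (W : Type) (M N : model S W) : Prop :=
  exists2 B, bisimulation B & B M N.

Definition acc (W : Type) (M : model S W) (m : modality S) (v : W) :
    set (model S W) :=
  [set N | exists i : idx M m v, model_eq N (succ M i)].

Inductive Ext (W : Type) (M : model S W) : set (model S W) :=
| Ext_self N : model_eq N M -> Ext M N
| Ext_acc N m v N' : Ext M N -> acc N m v N' -> Ext M N'.

(** Membership in a class may not distinguish two presentations of the same
    model, whence [mem_eq]. *)
Record model_class := ModelClass {
  mem_class :> forall W : Type, set (model S W);
  mem_eq : forall (W : Type) (M N : model S W),
    model_eq M N -> mem_class M -> mem_class N
}.

Definition closed_under_acc (C : model_class) : Prop :=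
  forall (W : Type) (M : model S W), C W M -> Ext M `<=` C W.

End Classes.

Section Satisfaction.
Variable S : signature.

Definition exists_in (T : Type) (P : T -> Prop) : seq T -> Prop :=
  fix loop s := if s is x :: s' then P x \/ loop s' else False.

Fixpoint sat_clit (W : Type) (M : model S W) (x : clit S) {struct x} : Prop :=
  match x with
  | Lit (Pos a) => valuation M (actual M) a
  | Lit (Neg a) => ~ valuation M (actual M) a
  | Box m C => forall N, acc M m (actual M) N -> exists_in (sat_clit N) C
  | NBox m C => ~ forall N, acc M m (actual M) N -> exists_in (sat_clit N) C
  end.

Definition sat_clause (W : Type) (M : model S W) (C : clause S) : Prop :=
  exists_in (sat_clit M) C.

Fixpoint sat (W : Type) (M : model S W) (phi : formula S) : Prop :=
  if phi is C :: phi' then sat_clause M C /\ sat M phi' else True.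

Definition Mod (C : model_class S) (phi : formula S) (W : Type) :
    set (model S W) :=
  [set M | C W M /\ sat M phi].

Definition entails (C : model_class S) (phi psi : formula S) : Prop :=
  forall W : Type, Mod C phi (W := W) `<=` Mod C psi (W := W).

End Satisfaction.

Section Permutations.
Variable S : signature.

Record permutation := Permutation {
  lperm_fun :> literal S -> literal S;
  lperm_inv : literal S -> literal S;
  lperm_funK : cancel lperm_fun lperm_inv;
  lperm_invK : cancel lperm_inv lperm_fun;
  lperm_finite : exists s : seq (literal S),
    forall l, l \notin s -> lperm_fun l = l
}.

Definition consistent (sigma : permutation) : Prop :=
  forall l, sigma (compl l) = compl (sigma l).

(** A family indexed by a literal means the family indexed by its atom, so
    that [sigma(k(a)) = k(sigma(a))] makes sense when [sigma(a)] is negative. *)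
Definition perm_modality (f : literal S -> literal S) (m : modality S) :
    modality S :=
  match m with
  | Plain p => Plain p
  | Indexed k a => Indexed k (atom_of (f (Pos a)))
  end.

Fixpoint perm_clit (sigma : permutation) (x : clit S) : clit S :=
  match x with
  | Lit l => Lit (sigma l)
  | Box m C => Box (perm_modality sigma m) (map (perm_clit sigma) C)
  | NBox m C => NBox (perm_modality sigma m) (map (perm_clit sigma) C)
  end.

Definition perm_clause (sigma : permutation) (C : clause S) : clause S :=
  map (perm_clit sigma) C.

Definition perm_formula (sigma : permutation) (phi : formula S) : formula S :=
  map (perm_clause sigma) phi.

Definition is_symmetry (sigma : permutation) (phi : formula S) : Prop :=
  formula_eq (perm_formula sigma phi) phi.

Definition true_literals (A : set (atom S)) : set (literal S) :=
  [set Pos a | a in A] `|` [set Neg a | a in ~` A].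

(** [R'(m, v)] is [{sigma(N) : N in R(sigma^-1(m), v)}], equivalently
    [R'(sigma(m), v) = {sigma(N) : N in R(m, v)}]. The inverse is what makes
    [M |= phi] equivalent to [sigma(M) |= sigma(phi)]; it can be replaced by
    [sigma] only when [sigma] acts on modalities as an involution. *)
CoFixpoint perm_model (sigma : permutation) (W : Type) (M : model S W) :
    model S W :=
  {| actual := actual M;
     valuation := fun v => Pos @^-1` (sigma @` true_literals (valuation M v));
     idx := fun m v => idx M (perm_modality (lperm_inv sigma) m) v;
     succ := fun m v i => perm_model sigma (succ M i) |}.

Definition closed_under_perm (sigma : permutation) (C : model_class S) : Prop :=
  forall (W : Type) (M : model S W), C W M -> C W (perm_model sigma M).

End Permutations.

(* Main.v *)
Require Import Defs.
From Stdlib Require List.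
From mathcomp Require Import all_boot.
From mathcomp Require Import boolp classical_sets.

Set Implicit Arguments.
Unset Strict Implicit.
Unset Printing Implicit Defensive.

(** For a consistent [sigma], [M |= x] iff [sigma(M) |= sigma(x)], so the models
    of [phi] in the class are stable under [sigma]. This gives the implication
    from [sigma(psi)] to [psi] at once. For the other one, [sigma] moves finitely
    many literals and hence has a finite order [n]: if [M |= phi] then
    [sigma^(n-1)(M) |= psi], so [sigma^n(M) |= sigma(psi) = sigma^n(sigma(psi))],
    and therefore [M |= sigma(psi)]. *)

(** * Members of sequences and iterates of maps *)

Section Sequences.
Variable T : Type.
Implicit Types (P : T -> Prop) (s t : seq T).

Lemma exists_inP P s : exists_in P s <-> exists2 x, List.In x s & P x.
Proof.
elim: s => [|x s IHs] /=; first by split=> // -[].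
rewrite IHs; split=> [[Px|[y sy Py]]|[y [<-|sy] Py]].
- by exists x => //; left.
- by exists y => //; right.
- by left.
- by right; exists y.
Qed.

Lemma exists_in_map U (f : U -> T) P (s : seq U) :
  exists_in P (map f s) <-> exists_in (fun x => P (f x)) s.
Proof. by elim: s => //= x s ->. Qed.

Lemma eq_exists_in P Q s :
  (forall x, List.In x s -> P x <-> Q x) -> exists_in P s <-> exists_in Q s.
Proof. by move=> PQ; rewrite !exists_inP; split=> -[x sx /PQ]; exists x; auto. Qed.

Lemma has_InP (a : pred T) s : has a s -> exists2 x, List.In x s & a x.
Proof.
elim: s => //= x s IHs /orP[ax|/IHs[y sy ay]]; first by exists x => //; left.
by exists y => //; right.
Qed.

Lemma all_InP (a : pred T) s : all a s -> forall x, List.In x s -> a x.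
Proof. by elim: s => //= x s IHs /andP[ax /IHs sa] y [<-|/sa]. Qed.

Lemma seteq_byP (e : T -> T -> bool) s t : seteq_by e s t ->
  (forall x, List.In x s -> exists2 y, List.In y t & e x y) /\
  (forall y, List.In y t -> exists2 x, List.In x s & e x y).
Proof.
by move=> /andP[/all_InP st /all_InP ts]; split=> x => [/st|/ts]/has_InP.
Qed.

Lemma iter_map (f : T -> T) n s : iter n (map f) s = map (iter n f) s.
Proof. by elim: n => [|n IHn] /=; rewrite ?map_id // IHn -map_comp. Qed.

Lemma eq_map_id (f : T -> T) s :
  (forall x, List.In x s -> f x = x) -> map f s = s.
Proof. by elim: s => //= x s IHs fs; rewrite fs ?IHs; auto. Qed.

Lemma iter_inj (f : T -> T) n : injective f -> injective (iter n f).
Proof. by move=> f_inj; elim: n => //= n IHn x y /f_inj/IHn. Qed.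

Lemma iter_fixed_mul (f : T -> T) n k x :
  iter n f x = x -> iter (k * n) f x = x.
Proof. by move=> fx; elim: k => // k IHk; rewrite mulSn iterD IHk. Qed.

End Sequences.

Section Symmetry.
Variable S : signature.

(** Clauses occur nested through [seq]; this principle supplies an induction hypothesis for every
    member of the clause under a modality. *)
Lemma clit_nested_ind (P : clit S -> Prop) :
  (forall l, P (Lit l)) ->
  (forall m C, (forall x, List.In x C -> P x) -> P (Box m C)) ->
  (forall m C, (forall x, List.In x C -> P x) -> P (NBox m C)) ->
  forall x, P x.
Proof.
move=> PL PB PN; fix IH 1.
case=> [l|m C|m C]; [exact: PL|apply: PB|apply: PN].
(* The inner induction on [C] exposes its members as subterms, so that the recursive call [IH] is
   guarded. *)
- by elim: C => [x []|y C IHC x [<-|]]; [exact: IH|exact: IHC].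
- by elim: C => [x []|y C IHC x [<-|]]; [exact: IH|exact: IHC].
Qed.

(** * Invariance of satisfaction under equality of formulas as sets and under equality of models *)

Section SatEq.
Variable W : Type.
Implicit Types (M N : model S W) (x y : clit S) (phi psi : formula S).

Lemma satP M phi : sat M phi <-> forall C, List.In C phi -> sat_clause M C.
Proof.
elim: phi => //= C phi ->; split=> [[MC Mphi] D [<-|/Mphi]//|Mphi].
by split=> [|D phiD]; apply: Mphi; auto.
Qed.

(** Every member of [D] is matched by one of [C], so assuming invariance on [C] alone serves both
    directions; an induction hypothesis on [C] has exactly this form. *)
Lemma clause_eq_exists_in (P : clit S -> Prop) C D :
  (forall x, List.In x C -> forall y, clit_eq x y -> P x <-> P y) ->
  clause_eq C D -> exists_in P C <-> exists_in P D.
Proof.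
move=> eP /seteq_byP[CD DC]; rewrite !exists_inP; split=> -[x].
  by move=> Cx Px; have [y Dy xy] := CD _ Cx; exists y => //; exact/(eP x).
by move=> Dx Px; have [y Cy yx] := DC _ Dx; exists y => //; exact/(eP y Cy x).
Qed.

Lemma sat_clit_eq x y M : clit_eq x y -> sat_clit M x <-> sat_clit M y.
Proof.
move: x y M; apply: clit_nested_ind => [l|m C IH|m C IH] [l'|m' D|m' D] M //=.
- by move=> /eqP->.
- move=> /andP[/eqP<- CD].
  have CDE N := clause_eq_exists_in (fun x Cx y => IH x Cx y N) CD.
  by split=> MC N /MC/CDE.
- move=> /andP[/eqP<- CD].
  have CDE N := clause_eq_exists_in (fun x Cx y => IH x Cx y N) CD.
  by split=> nMC MC; apply: nMC => N /MC/CDE.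
Qed.

Lemma sat_formula_eq M phi psi : formula_eq phi psi -> sat M phi -> sat M psi.
Proof.
move=> /seteq_byP[_ psiphi]; rewrite !satP => Mphi D /psiphi[C /Mphi MC CD].
by apply/(clause_eq_exists_in (fun x _ y => sat_clit_eq M) CD).
Qed.

Lemma model_eq_refl M : model_eq M M.
Proof.
by exists eq => // M1 _ <-; split=> // m v i; exists i.
Qed.

Lemma model_eq_sym M N : model_eq M N -> model_eq N M.
Proof.
move=> [B bisB BMN]; exists (fun M1 M2 => B M2 M1) => // M1 M2 /bisB.
by case=> eqa eqv MN NM; split.
Qed.

(** The relational composite of two bisimulations is a bisimulation. *)
Lemma model_eq_trans M N P : model_eq M N -> model_eq N P -> model_eq M P.
Proof.
move=> [B bisB BMN] [D bisD DNP].
exists (fun M1 P1 => exists2 N1, B M1 N1 & D N1 P1); last by exists N.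
move=> M1 P1 [N1 /bisB[aMN vMN MN NM] /bisD[aNP vNP NP PN]].
split=> [|v|m v i|m v k]; first by rewrite aMN.
- by rewrite vMN.
- have [j Bij] := MN m v i; have [k Djk] := NP m v j.
  by exists k, (succ N1 j).
- have [j Djk] := PN m v k; have [i Bij] := NM m v j.
  by exists i, (succ N1 j).
Qed.

Lemma model_eq_acc M N m v P : model_eq M N -> acc M m v P -> acc N m v P.
Proof.
move=> [B bisB /bisB[_ _ MN _]] [i Pi]; have [j Bij] := MN m v i.
by exists j; apply: model_eq_trans Pi _; exists B.
Qed.

(** A case analysis suffices: [acc] is saturated under [model_eq], so equal models have the same
    successors and the clause is evaluated in the same models. *)
Lemma sat_clit_model_eq x M N : model_eq M N -> sat_clit M x -> sat_clit N x.
Proof.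
move=> MN; have NM := model_eq_sym MN.
have [aMN vMN] : actual M = actual N /\ forall v, valuation M v = valuation N v.
  by case: MN => B bisB /bisB[].
case: x => [[a|a]|m C|m C] /=; rewrite ?vMN aMN //.
- by move=> MC P NP; apply/MC/(model_eq_acc NM).
- by move=> nMC NC; apply: nMC => P MP; apply/NC/(model_eq_acc MN).
Qed.

(** Passing from [acc] to indices lets [succ] of a permuted model be computed. *)
Lemma sat_boxP M m C :
  sat_clit M (Box m C) <->
  forall i : idx M m (actual M), sat_clause (succ M i) C.
Proof.
split=> [MC i|MC N [i /model_eq_sym eqN]].
  by apply: MC; exists i; exact: model_eq_refl.
have /exists_inP[x Cx ix] := MC i.
by apply/exists_inP; exists x => //; exact: sat_clit_model_eq eqN ix.
Qed.

End SatEq.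

(** * Transport of satisfaction along a consistent permutation *)

Section Consistent.
Variable sigma : permutation S.
Hypothesis sigmaN : consistent sigma.

Lemma lperm_inv_compl l : lperm_inv sigma (compl l) = compl (lperm_inv sigma l).
Proof.
by apply: (can_inj (lperm_funK sigma)); rewrite sigmaN !lperm_invK.
Qed.

Lemma atom_of_compl (l : literal S) : atom_of (compl l) = atom_of l.
Proof. by case: l. Qed.

(** By consistency the sign of a literal does not affect the atom of its image, so the sign dropped
    by [perm_modality] is harmless. *)
Lemma atom_of_perm l : atom_of (sigma (Pos (atom_of l))) = atom_of (sigma l).
Proof. by case: l => // a; rewrite -[in LHS]atom_of_compl -sigmaN. Qed.

Lemma atom_of_perm_inv l :
  atom_of (lperm_inv sigma (Pos (atom_of l))) = atom_of (lperm_inv sigma l).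
Proof. by case: l => // a; rewrite -[in LHS]atom_of_compl -lperm_inv_compl. Qed.

Lemma perm_modalityK :
  cancel (perm_modality sigma) (perm_modality (lperm_inv sigma)).
Proof. by case=> //= k a; rewrite atom_of_perm_inv lperm_funK. Qed.

Definition sat_lit (A : set (atom S)) (l : literal S) : Prop :=
  match l with Pos a => A a | Neg a => ~ A a end.

Lemma true_literalsP (A : set (atom S)) l : true_literals A l <-> sat_lit A l.
Proof.
case: l => a; split=> [[[b Ab []]|[b Ab []]] //|Aa]; try by move=> <-.
- by left; exists a.
- by right; exists a.
Qed.

Lemma sat_lit_compl (A : set (atom S)) l : sat_lit A (compl l) <-> ~ sat_lit A l.
Proof. by case: l => a //=; split=> [Aa|/contrapT]. Qed.

Lemma valuation_perm W (M : model S W) v a :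
  valuation (perm_model sigma M) v a <->
  sat_lit (valuation M v) (lperm_inv sigma (Pos a)).
Proof.
rewrite -true_literalsP; split=> [[l Ml /= <-]|Ma]; first by rewrite lperm_funK.
by exists (lperm_inv sigma (Pos a)) => //; rewrite lperm_invK.
Qed.

Lemma sat_lit_perm W (M : model S W) v l :
  sat_lit (valuation (perm_model sigma M) v) (sigma l) <->
  sat_lit (valuation M v) l.
Proof.
have := valuation_perm M v; move: (perm_model sigma M) => N NvE.
case E: (sigma l) => [a|a] /=; rewrite NvE; first by rewrite -E lperm_funK.
(* Since [sigma l = Neg a], consistency makes [compl l] the preimage of [Pos a]; a double negation
   remains. *)
rewrite -[Pos a]/(compl (Neg a)) -E -sigmaN lperm_funK sat_lit_compl.
by split=> [/contrapT|Ml nMl]; last exact: nMl.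
Qed.

Lemma sat_clit_perm x W (M : model S W) :
  sat_clit (perm_model sigma M) (perm_clit sigma x) <-> sat_clit M x.
Proof.
move: x M.
have boxE m C (M : model S W) :
    (forall x, List.In x C -> forall M : model S W,
      sat_clit (perm_model sigma M) (perm_clit sigma x) <-> sat_clit M x) ->
    sat_clit (perm_model sigma M) (perm_clit sigma (Box m C)) <->
    sat_clit M (Box m C).
  (* The successors of [sigma(M)] along [sigma(m)] are indexed by those of [M] along [m], the
     inverse in [perm_model] cancelling [sigma]. *)
  move=> IH; rewrite [perm_clit _ _]/= !sat_boxP /= perm_modalityK.
  have CE N := eq_exists_in (fun x Cx => IH x Cx N).
  by split=> MC i; have := MC i; rewrite /sat_clause exists_in_map CE.
apply: clit_nested_ind => [l|m C IH|m C IH] M; last 2 first.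
- exact: boxE.
- by have MC := boxE m C M IH; split=> nMC /MC.
- have satE (N : model S W) k :
    sat_clit N (Lit k) <-> sat_lit (valuation N (actual N)) k by case: k.
  by rewrite [perm_clit _ _]/= !satE sat_lit_perm.
Qed.

Lemma sat_perm W (M : model S W) phi :
  sat (perm_model sigma M) (perm_formula sigma phi) <-> sat M phi.
Proof.
elim: phi => //= C phi ->; rewrite /sat_clause exists_in_map.
by rewrite (eq_exists_in (Q := sat_clit M)) // => x _; exact: sat_clit_perm.
Qed.

Lemma sat_perm_iter n W (M : model S W) phi :
  sat (iter n (@perm_model _ sigma W) M) (iter n (perm_formula sigma) phi) <->
  sat M phi.
Proof. by elim: n => //= n IHn; rewrite sat_perm. Qed.

Lemma iter_perm_clit n x :
  (forall l, iter n sigma l = l) -> iter n (perm_clit sigma) x = x.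
Proof.
move=> sn.
have modE m : iter n (perm_modality sigma) m = m.
  case: m => [p|k a]; first by elim: n {sn} => //= n ->.
  transitivity (Indexed k (atom_of (iter n sigma (Pos a)))); last by rewrite sn.
  by elim: n {sn} => //= n -> /=; rewrite atom_of_perm.
elim/clit_nested_ind: x => [l|m C IH|m C IH].
- by rewrite -[in RHS](sn l); elim: n {sn modE} => //= n ->.
(* With [m] and [C] on the right replaced by their [n]-fold images, both sides unfold alike by
   induction on [n]. *)
- rewrite -[in RHS](modE m) -[in RHS](eq_map_id IH) -iter_map.
  by elim: n {sn modE IH} => //= n ->.
- rewrite -[in RHS](modE m) -[in RHS](eq_map_id IH) -iter_map.
  by elim: n {sn modE IH} => //= n ->.
Qed.

Lemma iter_perm_formula n phi :
  (forall l, iter n sigma l = l) -> iter n (perm_formula sigma) phi = phi.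
Proof.
move=> sn; rewrite iter_map; apply: eq_map_id => C _.
by rewrite iter_map; apply: eq_map_id => x _; exact: iter_perm_clit.
Qed.

End Consistent.

(** The finite list [s] is stable under [sigma], so its members have finite orbits, and a product of
    their periods is a common period. Writing it [n.+1] keeps it positive. *)
Lemma lperm_order (sigma : permutation S) :
  exists n, forall l, iter n.+1 sigma l = l.
Proof.
have [s sP] := lperm_finite sigma.
have s_inj := can_inj (lperm_funK sigma).
have s_stable l : l \in s -> sigma l \in s.
  move=> sl; apply: contraT => nsl.
  (* Were [sigma l] outside [s], it would be fixed, and injectivity would give [sigma l = l]. *)
  by have /s_inj sll := sP _ nsl; rewrite sll sl in nsl.
have s_periodic l : l \in s -> exists n, iter n.+1 sigma l = l.
  move=> sl; have sn n : iter n sigma l \in s by elim: n => //= n; exact: s_stable.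
  (* Pigeonhole: the first [(size s).+1] iterates all lie in [s], so they cannot be distinct. *)
  have : looping sigma l (size s).
    apply: contraT; rewrite -looping_uniq => us.
    suff : (size s).+1 <= size s by rewrite ltnn.
    rewrite -[leqLHS](size_traject sigma l); apply: uniq_leq_size => // x.
    by move=> /trajectP[i _ ->].
  move=> /trajectP[i lis eqi]; exists (size s - i).-1.
  (* The iterates of orders [size s] and [i] agree; cancelling [i] applications leaves the period
     [size s - i]. *)
  rewrite prednK ?subn_gt0 //; apply: (@iter_inj _ _ i s_inj).
  by rewrite -iterD subnKC // ltnW.
have [n nP] : exists n, forall l, l \in s -> iter n.+1 sigma l = l.
  elim: (s) s_periodic => [|l t IHt] tP; first by exists 0.
  have [n nP] := tP l (mem_head _ _).
  have [k kP] : exists k, forall l, l \in t -> iter k.+1 sigma l = l.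
    by apply: IHt => l' tl'; apply: tP; rewrite inE tl' orbT.
  exists (n.+1 * k.+1).-1 => l'; rewrite prednK // inE => /predU1P[->|tl'].
    by rewrite mulnC; exact: iter_fixed_mul.
  by apply: iter_fixed_mul; exact: kP.
exists n => l; have [/nP //|/sP sl] := boolP (l \in s).
exact: iter_fix.
Qed.

End Symmetry.

Theorem theorem2 (S : signature) (phi psi : formula S) (sigma : permutation S)
    (C : model_class S) :
  consistent sigma -> is_symmetry sigma phi ->
  closed_under_acc C -> closed_under_perm sigma C ->
  entails C phi psi <-> entails C phi (perm_formula sigma psi).
Proof.
move=> sigmaN sym _ Csigma.
have Mod_perm W (M : model S W) : Mod C phi M -> Mod C phi (perm_model sigma M).
  move=> [CM Mphi]; split; first exact: Csigma.
  (* [sigma(M)] satisfies [sigma(phi)], which is [phi] as a set of sets. *)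
  by apply: sat_formula_eq sym _; rewrite sat_perm.
split=> ent W M Mphi; split; try by case: Mphi.
  have [n sn] := lperm_order sigma.
  have /ent[_ Mpsi] : Mod C phi (iter n (@perm_model _ sigma W) M).
    by elim: n {sn} => //= n; exact: Mod_perm.
  (* The finite order is applied to the formula, so [sigma^(n+1)(M)] need not be compared with
     [M]. *)
  rewrite -(sat_perm_iter sigmaN n.+1) iter_perm_formula //=.
  by rewrite sat_perm.
by have /ent[_] := Mod_perm _ _ Mphi; rewrite sat_perm.
Qed.
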